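(* For every $m\ge2$, the Möbius coinvariant of the complete graph $K_m$ is $\mu^\perp(K_m)=(m-2)\,H_{m-3}(m-1)$.
   Context: For a directed graph $G$ on vertices $[d]$ with edge multiset $E$ (loops and multiple edges allowed), let $v_e\in\mathbb{Z}^d$ be $\mathbf{e}_i-\mathbf{e}_j$ for $e=(i\to j)$, $i\ne j$, and $v_e=0$ for loops. $V_G=\{\lambda:E\to\mathbb{R}:\sum_e\lambda(e)v_e=0\}$, and the cographic arrangement $\mathcal{C}^\perp_G$ consists of the hyperplanes $H_e=\{\lambda\in V_G:\lambda(e)=0\}$ (the result does not depend on the orientation of edges). The Möbius coinvariant $\mu^\perp(G)$ is $|\mu_{L^\perp_G}(\hat0,\hat1)|$ for the intersection lattice $L^\perp_G$ of $\mathcal{C}^\perp_G$ ordered by reverse inclusion; equivalently $\mu^\perp(G)=T_G(0,1)$ ($T_G$ the Tutte polynomial), so $\mu^\perp(G)=0$ if $G$ has an isthmus. Hermite polynomials: $H_n(x)=\sum_M x^{a(M)}$ over all partial matchings $M$ of $K_n$, $a(M)$ the number of vertices not covered by $M$; $H_0=1$, $H_{-1}=0$. *)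

(* Defs.v *)
From HB Require Import structures.
From mathcomp Require Import all_boot all_order all_algebra.
From mathcomp Require Import reals.

Set Implicit Arguments.
Unset Strict Implicit.
Unset Printing Implicit Defensive.

Import Order.TTheory GRing.Theory Num.Theory.
Local Open Scope ring_scope.

Section Mobius.
Variables (disp : Order.disp_t) (T : finPOrderType disp).

(* [n] is fuel: [#|T|] bounds the length of every chain, see [mobiusE]. *)
Fixpoint mobius_rec (n : nat) (x y : T) : int :=
  if x == y then 1 else
  if n is n'.+1 then - \sum_(z : T | (x <= z)%O && (z < y)%O) mobius_rec n' x z
  else 0.

Definition mobius (x y : T) : int := mobius_rec #|T| x y.

Lemma mobius_rec_fuel n n' x y :
    (#|[set z : T | (z < y)%O]| <= n)%N -> (#|[set z : T | (z < y)%O]| <= n')%N ->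
  mobius_rec n x y = mobius_rec n' x y.
Proof.
have no_lt k z : (#|[set t : T | (t < k)%O]| <= 0)%N -> (z < k)%O = false.
  by rewrite leqn0 cards_eq0 => /eqP/setP/(_ z); rewrite !inE.
elim: n n' y => [|n IHn] [|n'] y hn hn' //=; case: eqP => // _.
- by rewrite big_pred0 ?oppr0 // => z; rewrite no_lt // andbF.
- by rewrite big_pred0 ?oppr0 // => z; rewrite no_lt // andbF.
congr (- _); apply: eq_bigr => z /andP[_ zy].
have lt_card : (#|[set t : T | (t < z)%O]| < #|[set t : T | (t < y)%O]|)%N.
  apply/proper_card/properP; split; last by exists z; rewrite !inE ?zy ?ltxx.
  by apply/subsetP => t; rewrite !inE => /lt_trans; apply.
by apply: IHn; rewrite -ltnS (leq_trans lt_card).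
Qed.

Lemma mobiusE x y : mobius x y =
  if x == y then 1 else - \sum_(z : T | (x <= z)%O && (z < y)%O) mobius x z.
Proof.
rewrite {1}/mobius (@mobius_rec_fuel _ #|T|.+1) ?(leqW, max_card) //=.
Qed.

End Mobius.

(* Vertices are ['I_d] and edges form a finite type, so loops and multiple edges
   are allowed. *)
Record digraph (d : nat) := Digraph {
  edge : finType;
  src : edge -> 'I_d;
  tgt : edge -> 'I_d
}.

Section Cographic.
Variables (R : realType) (d : nat) (G : digraph d).
Local Notation E := (edge G).

Definition edge_vec (e : E) : 'rV[R]_d :=
  if src e == tgt e then 0 else delta_mx 0 (src e) - delta_mx 0 (tgt e).

(* [R^o] is [R] viewed as a vector space over itself. *)
Definition edge_fun := {ffun E -> R^o}.

Definition boundary (lam : edge_fun) : 'rV[R]_d :=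
  \sum_(e : E) (lam e : R) *: edge_vec e.

Lemma boundary_is_linear : linear boundary.
Proof.
move=> a u v; rewrite /boundary scaler_sumr -big_split /=.
by apply: eq_bigr => e _; rewrite !ffunE scalerDl scalerA.
Qed.

HB.instance Definition _ :=
  GRing.isLinear.Build R edge_fun 'rV[R]_d *:%R boundary boundary_is_linear.

Definition edge_eval (e : E) (lam : edge_fun) : R^o := lam e.

Lemma edge_eval_is_linear e : linear (edge_eval e).
Proof. by move=> a u v; rewrite /edge_eval !ffunE. Qed.

HB.instance Definition _ e :=
  GRing.isLinear.Build R edge_fun R^o *:%R (edge_eval e) (edge_eval_is_linear e).

Definition cycle_space : {vspace edge_fun} := lker (linfun boundary).

Lemma mem_cycle_space (lam : edge_fun) :
  (lam \in cycle_space) = (boundary lam == 0).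
Proof. by rewrite memv_ker lfunE. Qed.

Definition cographic_hyperplane (e : E) : {vspace edge_fun} :=
  (cycle_space :&: lker (linfun (edge_eval e)))%VS.

Lemma mem_cographic_hyperplane e (lam : edge_fun) :
  (lam \in cographic_hyperplane e) = (lam \in cycle_space) && (lam e == 0).
Proof. by rewrite memv_cap [in RHS]/= memv_ker lfunE. Qed.

(* The empty intersection is the ambient space [cycle_space]. *)
Definition cographic_flat (A : {set E}) : {vspace edge_fun} :=
  (cycle_space :&: \bigcap_(e in A) cographic_hyperplane e)%VS.

Definition cographic_flats : seq {vspace edge_fun} :=
  [seq cographic_flat A | A : {set E}].

Definition cographic_lattice := seq_sub cographic_flats.

HB.instance Definition _ := Finite.on cographic_lattice.

Definition cographic_le (X Y : cographic_lattice) : bool :=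
  (val Y <= val X)%VS.

Lemma cographic_le_refl : reflexive cographic_le.
Proof. by move=> X; apply: subvv. Qed.

Lemma cographic_le_anti : antisymmetric cographic_le.
Proof.
move=> X Y /andP[YX XY]; apply/val_inj/eqP.
by rewrite eqEsubv; apply/andP.
Qed.

Lemma cographic_le_trans : transitive cographic_le.
Proof. by move=> Y X Z XY YZ; apply: subv_trans YZ XY. Qed.

HB.instance Definition _ := Order.Le_isPOrder.Build (Order.Disp tt tt)
  cographic_lattice cographic_le_refl cographic_le_anti cographic_le_trans.

Lemma cographic_flat_in (A : {set E}) : cographic_flat A \in cographic_flats.
Proof. by apply: image_f. Qed.

Definition cographic_bot : cographic_lattice := SeqSub (cographic_flat_in set0).
Definition cographic_top : cographic_lattice := SeqSub (cographic_flat_in setT).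

Lemma cographic_botP (X : cographic_lattice) : (cographic_bot <= X)%O.
Proof.
have /imageP[A _ XE] := valP X; apply: (_ : cographic_le _ _).
by rewrite /cographic_le XE capvS ?subvv // big_set0 subvf.
Qed.

Lemma cographic_topP (X : cographic_lattice) : (X <= cographic_top)%O.
Proof.
have /imageP[A _ XE] := valP X; apply: (_ : cographic_le _ _).
rewrite /cographic_le XE capvS ?subvv //.
by apply/subv_bigcapP => e _; apply: bigcapv_inf (subvv _); rewrite ?inE.
Qed.

Definition adj_without (e : E) : rel 'I_d := fun i j =>
  [exists f : E, (f != e) &&
     (((src f == i) && (tgt f == j)) || ((src f == j) && (tgt f == i)))].

Definition isthmus (e : E) : bool := ~~ connect (adj_without e) (src e) (tgt e).

(* If [e] is an isthmus then [cographic_hyperplane e] is all of [cycle_space]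
   (a loop of the dual matroid) and the coinvariant is 0 = T_G(0,1), whereas the
   lattice of flats does not see [e]. *)
Definition mobius_coinvariant : nat :=
  if [exists e : E, isthmus e] then 0%N
  else `|mobius cographic_bot cographic_top|%N.

End Cographic.

(* The complete graph, each edge {i < j} being directed from i to j if [o] holds
   of it and from j to i otherwise. *)
Definition complete_edge (m : nat) := {p : 'I_m * 'I_m | (p.1 < p.2)%N}.

Definition complete_digraph (m : nat) (o : complete_edge m -> bool) : digraph m :=
  @Digraph m (complete_edge m)
    (fun e => if o e then (val e).1 else (val e).2)
    (fun e => if o e then (val e).2 else (val e).1).

Definition is_partial_matching (n : nat) (M : {set {set 'I_n}}) : bool :=
  [forall e in M, #|e| == 2%N] && trivIset M.

Definition uncovered (n : nat) (M : {set {set 'I_n}}) : nat := #|~: cover M|.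

(* The index is an integer so that H_(-1) = 0 makes sense; the value at the other
   negative indices is irrelevant. *)
Definition hermite (k : int) : {poly int} :=
  match k with
  | Posz n => \sum_(M : {set {set 'I_n}} | is_partial_matching M) 'X^(uncovered M)
  | Negz _ => 0
  end.

(* Main.v *)
(** By Whitney's theorem the Moebius number is, up to sign, the sum of
    (-1)^|F| over the spanning forests F of K_m.  More generally, for a set W of
    vertices and Q inside W, sum (-1)^|F| over the edge sets F inside W that
    stay acyclic once the vertices of W \ Q are merged, that is, over which no
    nonzero chain has zero boundary at every vertex of Q.  Deciding for each
    vertex of Q which edge, if any, joins it to W \ Q, and contracting these
    edges, turns the pair (W, Q) into pairs (Q, Q'): this gives a recursion with
    binomial coefficients, solved by
    H_(q+1)(1 - n) + n H_q(1 - n) with n = |W| and q = |Q| because the Hermite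
    polynomials form an Appell sequence.  At n = q = m the three-term recurrence
    of H reduces this value to (m - 2) H_(m-3)(1 - m). *)

Require Import Defs.
From mathcomp Require Import all_boot all_order all_algebra.
From mathcomp Require Import boolp reals.
From mathcomp Require Import zify ring.

Set Implicit Arguments.
Unset Strict Implicit.
Unset Printing Implicit Defensive.

Import Order.TTheory GRing.Theory Num.Theory.
Local Open Scope ring_scope.

(** * Hermite numbers from the three-term recurrence *)

Fixpoint herm (n : nat) (x : int) : int :=
  match n with
  | 0 => 1
  | n1.+1 => match n1 with 0 => x | n2.+1 => x * herm n1 x + n1%:Z * herm n2 x end
  end.

(** At [n = 0] the truncated index [n.-1] is harmless because its coefficient is 0. *)
Lemma hermS n x : herm n.+1 x = x * herm n x + n%:Z * herm n.-1 x.
Proof. by case: n => [|n] //=; rewrite mulr1 mul0r addr0. Qed.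

Lemma herm_ge0 n x : 0 <= x -> 0 <= herm n x.
Proof.
move=> x0; have [] : 0 <= herm n x /\ 0 <= herm n.+1 x by
  elim: n => [|n [IH1 IH2]]; split=> //; rewrite hermS addr_ge0 ?mulr_ge0.
by [].
Qed.

Lemma hermN n x : herm n (- x) = (-1) ^+ n * herm n x.
Proof.
suff [] : herm n (- x) = (-1) ^+ n * herm n x /\
          herm n.+1 (- x) = (-1) ^+ n.+1 * herm n.+1 x by [].
elim: n => [|n [IH1 IH2]]; first by split; rewrite //= ?mulr1 ?expr1 ?mulN1r.
by split=> //; rewrite hermS [herm n.+2 x]hermS IH2 IH1 !exprS; ring.
Qed.

(** * Iterated differences of Hermite numbers and the closed form [forest_val] *)

Section IteratedDifference.
Variable k : int.

(** The operator sending g to g(. + 1) - k g, applied [u] times and read at [p]. If g q is the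
    moment E[Y^q], the value is E[Y^p (Y - k)^u]. *)
Fixpoint iter_diff (g : nat -> int) (u p : nat) : int :=
  if u is u'.+1 then iter_diff g u' p.+1 - k * iter_diff g u' p else g p.

Lemma iter_diff_lin (g1 g2 g : nat -> int) (a : int) u p :
  (forall q, g q = g1 q + a * g2 q) ->
  iter_diff g u p = iter_diff g1 u p + a * iter_diff g2 u p.
Proof. by move=> gE; elim: u p => //= u IH p; rewrite !IH; ring. Qed.

Lemma iter_diff_shift (g : nat -> int) u p :
  iter_diff (fun q => g q.+1) u p = iter_diff g u p.+1.
Proof. by elim: u p => //= u IH p; rewrite !IH. Qed.

(* Writing [herm p x] as the Gaussian moment E[(x + Z)^p], the left-hand side
   is E[(x + Z)^(p+1) (x - k + Z)^u] and this is integration by parts. *)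
Lemma iter_diff_herm_parts x u p :
  let w := iter_diff (herm ^~ x) in
  w u p.+1 = x * w u p + p%:Z * w u p.-1 + u%:Z * w u.-1 p.
Proof.
move=> w.
have w0 q : w 0%N q = herm q x by [].
have wS v q : w v.+1 q = w v q.+1 - k * w v q by [].
clearbody w; elim: u p => [|u IH] p; first by rewrite !w0 hermS mul0r addr0.
(* The factors [u] and [p] absorb the boundary cases where [u.-1] or [p.-1] is truncated. *)
have upd : u%:Z * w u p = u%:Z * (w u.-1 p.+1 - k * w u.-1 p).
  by case: (u) => [|u'] /=; rewrite ?mul0r // wS.
have ppd : p%:Z * w u p.-1.+1 = p%:Z * w u p by case: (p) => //; rewrite !mul0r.
rewrite wS IH [X in _ - k * X]IH !wS [_.+1.-1]/= [_.+1.-1]/=.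
have -> : u.+1%:Z * w u p = w u p + u%:Z * w u p by rewrite -addn1 PoszD; ring.
have -> : p.+1%:Z * w u p = w u p + p%:Z * w u p by rewrite -addn1 PoszD; ring.
by rewrite upd !mulrBr ppd; ring.
Qed.

(** This is the Appell property: at [p = 0], integration by parts becomes the recurrence [hermS]
    with argument [x - k]. *)
Lemma iter_diff_herm x n : iter_diff (herm ^~ x) n 0 = herm n (x - k).
Proof.
pose w := iter_diff (herm ^~ x); rewrite -/w.
have wS u : w u.+1 0%N = (x - k) * w u 0%N + u%:Z * w u.-1 0%N.
  have -> : w u.+1 0%N = w u 1%N - k * w u 0%N by [].
  by rewrite [w u 1%N]iter_diff_herm_parts -/w /=; ring.
suff [] : w n 0%N = herm n (x - k) /\ w n.+1 0%N = herm n.+1 (x - k) by [].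
elim: n => [|n [IH1 IH2]]; first by rewrite wS !hermS /=; split=> //; rewrite mul0r.
by split=> //; rewrite wS hermS /= IH1 IH2.
Qed.

End IteratedDifference.

(* The sum attached to (W, Q) for [#|W| = n] and [#|Q| = q]. *)
Definition forest_val (n q : nat) : int :=
  herm q.+1 (1 - n%:Z) + n%:Z * herm q (1 - n%:Z).

Lemma iter_diff_forest_val (k n : nat) :
  iter_diff k%:Z (forest_val n) n 0 = forest_val (k + n) n.
Proof.
pose x : int := 1 - n%:Z.
rewrite (@iter_diff_lin _ (fun q => herm q.+1 x) (herm ^~ x) _ n%:Z) //.
rewrite (iter_diff_shift _ (herm ^~ x)).
(* Trading the shift for one more difference adds [k] to the coefficient [n], which gives the
   coefficient [k + n] of the target. *)
have -> : iter_diff k%:Z (herm ^~ x) n 1 =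
    iter_diff k%:Z (herm ^~ x) n.+1 0 + k%:Z * iter_diff k%:Z (herm ^~ x) n 0.
  by rewrite /=; ring.
rewrite !iter_diff_herm /forest_val.
have -> : 1 - (k + n)%:Z = x - k%:Z by rewrite /x PoszD; ring.
by rewrite PoszD; ring.
Qed.

(** The argument is -n, so the recurrence leaves [herm n.+1] with coefficient (n + 1) - n = 1. This
    is the numerical counterpart of [indep_drop]. *)
Lemma forest_val_drop n : forest_val n.+1 n.+1 = forest_val n.+1 n.
Proof. by rewrite /forest_val hermS /=; ring. Qed.

(** After the drop, two uses of the recurrence at argument -(n + 2) make the [herm n.+1] terms
    cancel. *)
Lemma forest_val_top n :
  forest_val n.+3 n.+3 = n.+1%:Z * herm n (1 - n.+3%:Z).
Proof. by rewrite forest_val_drop /forest_val hermS [herm n.+2 _]hermS /=; ring. Qed.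

(** * Signed sums over independent edge sets, with deletion and contraction *)

Section IndependentSum.
Variables (K : fieldType) (E V : finType) (inc : E -> V -> K).

(** Linear independence of the rows of [inc] indexed by [F], restricted to the columns in [Q].
    Chains are functions on all of [E] supported in [F]. *)
Definition indep (Q : {set V}) (F : {set E}) : bool :=
  `[< forall f : E -> K, (forall e, e \notin F -> f e = 0) ->
      (forall v, v \in Q -> \sum_e f e * inc e v = 0) -> forall e, f e = 0 >].

Definition indep_sum (D : {set E}) (Q : {set V}) : int :=
  \sum_(F : {set E} | (F \subset D) && indep Q F) (-1) ^+ #|F|.

Lemma sum_delta (e : E) (c : K) v : \sum_a (c * (a == e)%:R) * inc a v = c * inc e v.
Proof.
rewrite (bigD1 e) //= eqxx mulr1 big1 ?addr0 // => a /negPf ->.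
by rewrite mulr0 mul0r.
Qed.

Lemma indep0 Q : indep Q set0.
Proof. by apply/asboolP => f f0 _ e; rewrite f0 ?inE. Qed.

Lemma indep_loop (Q : {set V}) F e :
  {in Q, forall v, inc e v = 0} -> indep Q F -> e \notin F.
Proof.
move=> e0 /asboolP indF; apply/negP => eF.
have /eqP : 1 * (e == e)%:R = 0 :> K.
  apply: (indF (fun a => 1 * (a == e)%:R)) => [a aF|v vQ].
    by case: eqP aF => [->|]; rewrite ?eF // mulr0.
  by rewrite sum_delta e0 // mulr0.
by rewrite eqxx mulr1 oner_eq0.
Qed.

(** Inside [Q] the row of [e] is nonzero only at [u], so the equation at [u] determines the
    coefficient of [e] and constrains nothing else. Contracting [e] thus amounts to forgetting
    [u]. *)
Lemma indep_contract (Q : {set V}) (F : {set E}) e u :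
  e \notin F -> u \in Q -> inc e u != 0 ->
  {in Q :\ u, forall v, inc e v = 0} ->
  indep Q (e |: F) = indep (Q :\ u) F.
Proof.
move=> eF uQ eu ev; apply/asboolP/asboolP => ind f fF fQ a.
(* The coefficient on [e] that makes the boundary at [u] vanish. *)
- pose c := - (\sum_b f b * inc b u) / inc e u.
  pose g b := f b + c * (b == e)%:R.
  have gE v : \sum_b g b * inc b v = \sum_b f b * inc b v + c * inc e v.
    by rewrite -sum_delta -big_split /=; apply: eq_bigr => b _; rewrite mulrDl.
  have [->|ae] := eqVneq a e; first exact: fF.
  have := ind g; rewrite /g => /(_ _ _ a); rewrite (negPf ae) mulr0 addr0.
  apply=> [b|v vQ]; first rewrite !inE negb_or => /andP[/negPf -> bF].
    by rewrite fF // mulr0 addr0.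
  rewrite gE; have [->|vu] := eqVneq v u; first by rewrite /c divfK ?subrr.
  by rewrite fQ ?ev ?mulr0 ?addr0 // !inE vu.
(* Removing the [e] component changes the boundary, within [Q], only at [u]. *)
- pose g b := f b + - f e * (b == e)%:R.
  have gE v : \sum_b g b * inc b v = \sum_b f b * inc b v + - f e * inc e v.
    by rewrite -sum_delta -big_split /=; apply: eq_bigr => b _; rewrite mulrDl.
  have g0 b : g b = 0.
    apply: ind b => [b bF|v]; last first.
      by move=> vQ; rewrite gE ev // fQ ?mulr0 ?addr0 //; move: vQ; rewrite !inE => /andP[].
    rewrite /g; have [->|be] := eqVneq b e; first by rewrite mulr1 subrr.
    by rewrite mulr0 addr0 fF // !inE negb_or be.
  have fe b : f b = f e * (b == e)%:R.
    by apply/eqP; rewrite -subr_eq0 -mulNr; apply/eqP/g0.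
  have : \sum_b f b * inc b u = 0 by exact: fQ.
  under eq_bigr do rewrite fe.
  rewrite sum_delta => /eqP; rewrite mulf_eq0 (negPf eu) orbF => /eqP fe0.
  by rewrite fe fe0 mul0r.
Qed.

Lemma indep_sum_loops (D X : {set E}) (Q : {set V}) :
  {in X & Q, forall e v, inc e v = 0} -> indep_sum D Q = indep_sum (D :\: X) Q.
Proof.
move=> X0; apply: eq_bigl => F; case indF: (indep Q F); rewrite ?andbF // !andbT.
rewrite subsetD; case: (F \subset D) => //=; apply/esym.
rewrite disjoint_sym disjoint_subset; apply/subsetP => e eX.
by apply: indep_loop indF => v vQ; apply: X0.
Qed.

(** Split according to whether [e] belongs to [F]; removing [e] from [F] costs a sign. *)
Lemma indep_sum_contract (D : {set E}) (Q : {set V}) e u :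
  e \in D -> u \in Q -> inc e u != 0 ->
  {in Q :\ u, forall v, inc e v = 0} ->
  indep_sum D Q = indep_sum (D :\ e) Q - indep_sum (D :\ e) (Q :\ u).
Proof.
move=> eD uQ eu ev; rewrite /indep_sum (bigID (fun F : {set E} => e \in F)) /= addrC.
congr (_ + _).
  by apply: eq_bigl => F; rewrite subsetD1; case: (e \in F); rewrite ?andbF ?andbT.
rewrite (reindex_onto (fun F => e |: F) (fun F => F :\ e)) /=; last first.
  by move=> F /andP[_ eF]; rewrite setD1K.
rewrite -sumrN; apply: eq_big => F => [|/andP[_ /eqP FE]].
  rewrite setU11 andbT subUset sub1set eD /= subsetD1.
  have [eF|eF] := boolP (e \in F); last by rewrite setU1K // eqxx !andbT (indep_contract eF uQ eu ev).
  rewrite andbF andFb; apply/negP => /andP[_ /eqP FE].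
  by move: eF; rewrite -FE !inE eqxx.
have eF : e \notin F by rewrite -FE !inE eqxx.
by rewrite cardsU1 eF exprD expr1 mulN1r.
Qed.

(** The edges of [X] are parallel inside [Q]: once one of them is contracted, the others are loops
    and disappear. Each edge of [X] therefore contributes the same contraction term. *)
Lemma indep_sum_star (D X : {set E}) (Q : {set V}) u :
  X \subset D -> u \in Q -> {in X, forall e, inc e u != 0} ->
  {in X & Q :\ u, forall e v, inc e v = 0} ->
  indep_sum D Q = indep_sum (D :\: X) Q - #|X|%:Z * indep_sum (D :\: X) (Q :\ u).
Proof.
move=> XD uQ Xu Xv; move: {2}#|X| (erefl #|X|) => n cX.
elim: n X D XD Xu Xv cX => [|n IH] X D XD Xu Xv cX.
  by rewrite cX (cards0_eq cX) setD0 mul0r subr0.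
have /card_gt0P[e eX] : (0 < #|X|)%N by rewrite cX.
have XE : (D :\ e) :\: (X :\ e) = D :\: X.
  by apply/setP => a; rewrite !inE; case: eqP => [->|]; rewrite ?eX.
have cXe : #|X :\ e| = n by apply/eqP; rewrite -eqSS -cX (cardsD1 e X) eX.
have sX a : a \in X :\ e -> a \in X by rewrite inE => /andP[].
rewrite (@indep_sum_contract _ _ e u) ?(subsetP XD) ?Xu //; last first.
  by move=> v vQ; apply: Xv.
rewrite (IH (X :\ e)) ?setSD //; last 2 first.
- by move=> a /sX; apply: Xu.
- by move=> a v /sX aX vQ; apply: Xv.
rewrite (@indep_sum_loops (D :\ e) (X :\ e) (Q :\ u)); last first.
  by move=> a v /sX aX vQ; apply: Xv.
by rewrite XE cXe cX -addn1 PoszD; ring.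
Qed.

End IndependentSum.

(** * The recursion on complete graphs, described by an abstract incidence matrix *)

Section CompleteGraph.
Variables (K : fieldType) (E V : finType) (inc : E -> V -> K).

Definition ends (e : E) : {set V} := [set v | inc e v != 0].

Hypothesis card_ends : forall e, #|ends e| = 2%N.
Hypothesis ends_inj : injective ends.
Hypothesis ends_surj : forall a b : V, a != b -> exists e, ends e = [set a; b].
Hypothesis sum_inc : forall e, \sum_v inc e v = 0.

Local Notation N := (indep_sum inc).

Definition edges_in (W : {set V}) : {set E} := [set e | ends e \subset W].

Definition edges_between (S U : {set V}) : {set E} :=
  [set e | [exists s in S, exists u in U, ends e == [set s; u]]].

Lemma edges_betweenP (S U : {set V}) e :
  reflect (exists s u, [/\ s \in S, u \in U & ends e = [set s; u]])
          (e \in edges_between S U).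
Proof.
rewrite inE; apply: (iffP existsP) => [[s /andP[sS /existsP[u /andP[uU /eqP eE]]]]|].
  by exists s, u.
move=> [s [u [sS uU eE]]]; exists s; rewrite sS; apply/existsP; exists u.
by rewrite uU eE eqxx.
Qed.

Lemma inc_eq0 e v : v \notin ends e -> inc e v = 0.
Proof. by rewrite inE negbK => /eqP. Qed.

Lemma card_edges_between1 (S : {set V}) u :
  u \notin S -> #|edges_between S [set u]| = #|S|.
Proof.
move=> uS; have neq s : s \in S -> s != u by apply: contraTneq => ->.
rewrite -(card_imset _ ends_inj).
have -> : [set ends e | e in edges_between S [set u]] = [set [set s; u] | s in S].
  apply/setP => A; apply/imsetP/imsetP => [[e /edges_betweenP[s [v]]]|[s sS ->]].
    by rewrite inE => -[sS /eqP -> eE] ->; exists s.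
  have [e eE] := ends_surj (neq s sS); exists e => //.
  by apply/edges_betweenP; exists s, u; rewrite inE.
apply: card_in_imset => s t sS tS /setP/(_ s).
by rewrite !inE eqxx (negPf (neq s sS)) /= orbF => /esym/eqP.
Qed.

(** The vertices of [S] lie outside [Q], hence count as merged, and each [u] in [U] has [#|S|]
    parallel edges to them. Using none keeps [u] in [Q]; using one removes [u]. This is one step of
    [iter_diff] with [k = #|S|]. *)
Lemma indep_sum_between (S W U Q : {set V}) :
  [disjoint S & W] -> U \subset Q -> Q \subset W ->
  (forall P : {set V}, P \subset W -> N (edges_in W) P = forest_val #|W| #|P|) ->
  N (edges_in W :|: edges_between S U) Q =
    iter_diff #|S|%:Z (forest_val #|W|) #|U| (#|Q| - #|U|)%N.
Proof.
move=> SW UQ QW base; move: {2}#|U| (erefl #|U|) => n cU.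
elim: n U Q cU UQ QW => [|n IH] U Q cU UQ QW.
  have -> : edges_between S U = set0.
    apply/setP => e; rewrite in_set0; apply/negP => /edges_betweenP[s [u [_]]].
    by rewrite (cards0_eq cU) inE.
  by rewrite setU0 cU subn0 base.
have /card_gt0P[u uU] : (0 < #|U|)%N by rewrite cU.
have uQ := subsetP UQ _ uU; have uW := subsetP QW _ uQ.
have notS v : v \in W -> v \notin S by move=> vW; rewrite (disjointFl SW).
have cUu : #|U :\ u| = n by apply/eqP; rewrite -eqSS -cU (cardsD1 u U) uU.
have cQu : #|Q| = #|Q :\ u|.+1 by rewrite (cardsD1 u) uQ.
have leUQ : (#|U| <= #|Q|)%N by apply: subset_leq_card.
rewrite (@indep_sum_star _ _ _ _ _ (edges_between S [set u]) _ u) //; first last.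
- move=> e v /edges_betweenP[s [u' [sS]]]; rewrite inE => /eqP -> eE.
  rewrite !inE => /andP[vu vQ]; apply: inc_eq0; rewrite eE !inE (negPf vu) orbF.
  by apply: contraTneq sS => <-; apply/notS/(subsetP QW).
- move=> e /edges_betweenP[s [u' [sS]]]; rewrite inE => /eqP -> eE.
  have : u \in ends e by rewrite eE !inE eqxx orbT.
  by rewrite inE.
- apply/subsetP => e /edges_betweenP[s [u' [sS]]]; rewrite inE => /eqP -> eE.
  by rewrite inE; apply/orP; right; apply/edges_betweenP; exists s, u.
have -> : (edges_in W :|: edges_between S U) :\: edges_between S [set u] =
          edges_in W :|: edges_between S (U :\ u).
  apply/setP => e; rewrite in_setD !in_setU; apply/andP/orP.
    move=> [eu /orP[eW|/edges_betweenP[s [v [sS vU eE]]]]]; [by left|right].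
    apply/edges_betweenP; exists s, v; split=> //; rewrite !inE vU andbT.
    apply: contraNneq eu => vu; apply/edges_betweenP; exists s, v.
    by rewrite vu set11 -vu; split.
  move=> [eW|/edges_betweenP[s [v [sS]]]].
    split; last by rewrite eW.
    apply/negP => /edges_betweenP[s [u' [sS _ eE]]].
    move: eW; rewrite inE eE => /subsetP/(_ s); rewrite !inE eqxx => /(_ isT) /notS.
    by rewrite sS.
  rewrite in_setD1 => /andP[vu vU] eE; split; last first.
    by apply/orP; right; apply/edges_betweenP; exists s, v.
  apply/negP => /edges_betweenP[s' [u' [s'S]]].
  rewrite inE => /eqP -> eE'; move: (eE'); rewrite eE => /setP/(_ v).
  rewrite !inE eqxx orbT (negPf vu) orbF => /esym/eqP vs.
  by move: s'S; rewrite -vs; apply/negP/notS/(subsetP QW)/(subsetP UQ).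
rewrite card_edges_between1 ?notS // cU /=.
rewrite (IH (U :\ u) Q) ?(subset_trans (subsetDl _ _)) //.
rewrite (IH (U :\ u) (Q :\ u)) ?setSD ?(subset_trans (subsetDl _ _)) //.
(* The gap between [Q] and [U] grows by one when [u] stays in [Q], and is unchanged when [u] leaves
   both. *)
have -> : (#|Q| - #|U :\ u|)%N = (#|Q| - n.+1).+1 by lia.
have -> : (#|Q :\ u| - #|U :\ u|)%N = (#|Q| - n.+1)%N by lia.
by rewrite cUu.
Qed.

Lemma edges_in_setD (W S : {set V}) : S \subset W ->
  edges_in W :\: edges_in S = edges_in (W :\: S) :|: edges_between S (W :\: S).
Proof.
move=> SW; apply/setP => e.
have /eqP/cards2P[a [b [ab eE]]] := card_ends e.
rewrite !inE eE !subUset !sub1set !inE.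
apply/idP/idP.
  move=> /andP[h /andP[aW bW]]; rewrite aW bW !andbT.
  have [aS|aS] /= := boolP (a \in S).
    apply/existsP; exists a; rewrite aS; apply/existsP; exists b.
    by move: h; rewrite !inE aS bW eqxx /= andbT => ->.
  have [bS|bS] //= := boolP (b \in S).
  apply/existsP; exists b; rewrite bS; apply/existsP; exists a.
  by rewrite !inE aS aW setUC eqxx.
move=> /orP[/andP[/andP[/negPf-> ->] /andP[_ ->]] //|].
move=> /existsP[s /andP[sS /existsP[u /andP[uU /eqP E2]]]].
move: uU; rewrite !inE => /andP[uS uW]; have sW := subsetP SW _ sS.
have eq_ab v : (v == a) || (v == b) = (v == s) || (v == u).
  by move/setP: E2 => /(_ v); rewrite !inE.
have aW : a \in W by have := eq_ab a; rewrite eqxx => /esym/orP[]/eqP ->.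
have bW : b \in W by have := eq_ab b; rewrite eqxx orbT => /esym/orP[]/eqP ->.
rewrite aW bW !andbT; apply: contra uS => /andP[aS bS].
by have := eq_ab u; rewrite eqxx orbT => /orP[]/eqP ->.
Qed.

(** Edges inside [W :\: Q] are loops for [Q]. What remains is the complete graph on [Q] and its
    edges to [W :\: Q], so the problem passes to the smaller set [Q]. *)
Lemma indep_sum_edges_in_proper (W Q : {set V}) : Q \proper W ->
  (forall P : {set V}, P \subset Q -> N (edges_in Q) P = forest_val #|Q| #|P|) ->
  N (edges_in W) Q = forest_val #|W| #|Q|.
Proof.
move=> /proper_sub QW base; set S := W :\: Q.
have WS : W :\: S = Q.
  by rewrite /S setDDr setDv set0U; apply/setIidPr.
have SW : S \subset W by apply: subsetDl.
have SQ : [disjoint S & Q].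
  by rewrite -setI_eq0 /S setIDAC setDIl setDv setI0.
rewrite (@indep_sum_loops _ _ _ _ _ (edges_in S)); last first.
  move=> e v; rewrite inE => eS vQ; apply/inc_eq0/negP => /(subsetP eS).
  by rewrite (disjointFl SQ).
rewrite edges_in_setD // WS indep_sum_between // subnn iter_diff_forest_val.
by rewrite -WS [in (_ + _)%N]cardsDS // subnKC ?subset_leq_card.
Qed.

(** The boundary of a chain sums to 0 over all vertices, and edges inside [W] have no boundary
    outside [W]. Vanishing on [W :\ u] thus forces vanishing at [u]. *)
Lemma indep_drop (W : {set V}) (F : {set E}) u :
  F \subset edges_in W -> u \in W -> indep inc W F = indep inc (W :\ u) F.
Proof.
move=> FW uW; apply/asboolP/asboolP => ind f fF fW; apply: ind => // v vW; last first.
  by apply: fW; move: vW; rewrite inE => /andP[].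
have [->|vu] := eqVneq v u; last by apply: fW; rewrite !inE vu.
have : \sum_w \sum_e f e * inc e w = 0.
  by rewrite exchange_big big1 //= => e _; rewrite -mulr_sumr sum_inc mulr0.
rewrite (bigD1 u) //= [X in _ + X]big1 ?addr0 // => w wu.
have [wW|wW] := boolP (w \in W); first by apply: fW; rewrite !inE wu.
rewrite big1 // => e _; have [eF|eF] := boolP (e \in F); last by rewrite fF // mul0r.
rewrite inc_eq0 ?mulr0 //; apply: contra wW => wE.
by move: (subsetP FW _ eF); rewrite inE => /subsetP; apply.
Qed.

Lemma indep_sum_edges_in (W Q : {set V}) : Q \subset W ->
  N (edges_in W) Q = forest_val #|W| #|Q|.
Proof.
move: {2}#|W|.+1 (ltnSn #|W|) => n; elim: n W Q => // n IH W Q leW QW.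
have proper_case (P : {set V}) : P \proper W -> N (edges_in W) P = forest_val #|W| #|P|.
  move=> PW; apply: indep_sum_edges_in_proper => // P' P'P; apply: IH => //.
  by apply: leq_trans (proper_card PW) _.
move: QW; rewrite subEproper => /orP[/eqP ->|]; last exact: proper_case.
have [->|[u uW]] := set_0Vmem W.
  (* For empty [W] only the empty edge set counts, and [forest_val 0 0] is 1. *)
  rewrite cards0 /indep_sum (big_pred1 set0) ?cards0 // => F.
  rewrite -[RHS]subset0; have -> : edges_in set0 = set0.
    apply/setP => e; rewrite !inE subset0 -cards_eq0 card_ends //.
  by rewrite subset0; case: eqP => // ->; rewrite indep0.
transitivity (N (edges_in W) (W :\ u)).
  by apply: eq_bigl => F; case FW: (F \subset _) => //=; rewrite (indep_drop FW uW).
have cW : #|W| = #|W :\ u|.+1 by rewrite (cardsD1 u) uW.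
by rewrite proper_case ?properD1 // cW forest_val_drop.
Qed.

End CompleteGraph.

(** * The matching polynomial satisfies the Hermite recurrence *)

Section Matchings.
Variable T : finType.

(** Relative to a vertex set [A], so that vertices can be removed in an induction without changing
    the type. *)
Definition matching_on (A : {set T}) (M : {set {set T}}) : bool :=
  [&& [forall e in M, #|e| == 2%N], trivIset M & cover M \subset A].

Lemma matching_onD1 (A : {set T}) a M :
  matching_on (A :\ a) M = matching_on A M && (a \notin cover M).
Proof. by rewrite /matching_on subsetD1 !andbA. Qed.

Lemma matching_on_add (A : {set T}) a b (M : {set {set T}}) :
  a \in A -> b \in A -> a != b ->
  matching_on A ([set a; b] |: M) && ([set a; b] \notin M) =
  matching_on (A :\ a :\ b) M.
Proof.
move=> aA bA ab; pose p : {set T} := [set a; b]; rewrite -/p.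
have covU : cover (p |: M) = p :|: cover M.
  by rewrite /cover bigcup_setU big_set1.
apply/andP/and3P.
  move=> [/and3P[/forall_inP c2 tr cA] pM]; split.
  - by apply/forall_inP => e eM; apply: c2; rewrite !inE eM orbT.
  - by apply: trivIsetS tr; apply: subsetUr.
  have notin v : v \in p -> v \notin cover M.
    move=> vp; apply/bigcupP => -[B BM vB].
    have pB : p != B by apply: contraNneq pM => ->.
    have := trivIsetP tr p B (setU11 _ _) (setU1r _ BM) pB.
    by move=> /disjoint_setI0/setP/(_ v); rewrite in_setI vp vB inE.
  rewrite !subsetD1 !notin ?inE ?eqxx ?orbT // !andbT.
  by apply: subset_trans cA; rewrite covU subsetUr.
move=> [c2 tr]; rewrite !subsetD1 => /andP[/andP[cA aM] bM].
have pdisj B : B \in M -> [disjoint p & B].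
  move=> BM; rewrite -setI_eq0; apply/eqP/setP => v; rewrite !inE.
  apply/negP => /andP[/orP[]/eqP -> vB]; [move/negP: aM|move/negP: bM];
  by apply; apply/bigcupP; exists B.
have s0 : set0 \notin M.
  by apply/negP => /(forall_inP c2); rewrite cards0.
have [trU pM] := trivIsetU1 pdisj tr s0.
split=> //; apply/and3P; split=> //.
  apply/forall_inP => e; rewrite !inE => /orP[/eqP ->|]; last exact: (forall_inP c2).
  by rewrite cards2 ab.
by rewrite covU subUset cA andbT; apply/subsetP => v; rewrite !inE => /orP[]/eqP ->.
Qed.

Lemma matching_on_edge_uniq (A : {set T}) M a b c :
  matching_on A M -> [set a; b] \in M -> [set a; c] \in M -> a != b -> b = c.
Proof.
move=> /and3P[_ tr _] bM cM ab; have [E|ne] := eqVneq [set a; b] [set a; c].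
  by move/setP: E => /(_ b); rewrite !inE eqxx orbT eq_sym (negPf ab) => /esym/eqP.
have := trivIsetP tr _ _ bM cM ne.
by move=> /disjoint_setI0/setP/(_ a); rewrite !inE eqxx.
Qed.

Lemma matching_on_edge_ex (A : {set T}) M a :
  matching_on A M -> a \in cover M -> exists2 b, b \in A :\ a & [set a; b] \in M.
Proof.
move=> /and3P[/forall_inP c2 _ cA] /bigcupP[B BM aB].
have /cards2P[c [d [cd BE]]] := c2 _ BM.
have BA : B \subset A by apply: subset_trans cA; apply: bigcup_sup.
move: aB; rewrite BE !inE => /orP[]/eqP ae.
  exists d; last by rewrite ae -BE.
  by rewrite !inE ae eq_sym cd (subsetP BA) // BE !inE eqxx orbT.
exists c; last by rewrite ae setUC -BE.
by rewrite !inE ae cd (subsetP BA) // BE !inE eqxx.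
Qed.

(** Fix [a] in [A]. Matchings missing [a] give a factor [x]; the others are sorted by the partner of
    [a], with [#|A| - 1] choices. This is [hermS]. *)
Lemma matching_sum (A : {set T}) (x : int) :
  \sum_(M | matching_on A M) x ^+ #|A :\: cover M| = herm #|A| x.
Proof.
move: {2}#|A|.+1 (ltnSn #|A|) => n; elim: n A => // n IH A ltA.
have [->|[a aA]] := set_0Vmem A.
  rewrite (big_pred1 set0) => [|M]; first by rewrite set0D cards0.
  apply/and3P/eqP => [[c2 _]|->]; last first.
    by rewrite /trivIset /cover !big_set0 cards0; split=> //; apply/forall_inP => e; rewrite inE.
  rewrite subset0 => /eqP c0; apply/setP => B; rewrite inE; apply/negP => BM.
  have : B \subset set0 by rewrite -c0; apply: bigcup_sup.
  by rewrite subset0 => /eqP B0; move/forall_inP: c2 => /(_ B BM); rewrite B0 cards0.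
have cA : #|A| = #|A :\ a|.+1 by rewrite (cardsD1 a) aA.
rewrite (bigID (fun M => a \notin cover M)) /= cA hermS; congr (_ + _).
  rewrite -IH -?cA // big_distrr /=; apply: eq_big => M; first by rewrite matching_onD1.
  move=> /andP[_ aM]; rewrite -exprS; congr (x ^+ _).
  by rewrite (cardsD1 a) in_setD aM aA /= setDDl setUC -setDDl setDDl setUC.
(* The partner of [a]; the default [a] lies outside [A :\ a], so it is never mistaken for a
   partner. *)
pose mate (M : {set {set T}}) := odflt a [pick b | (b != a) && ([set a; b] \in M)].
have mateP M b : matching_on A M -> b \in A :\ a ->
    (a \in cover M) && (mate M == b) = ([set a; b] \in M).
  rewrite !inE => mM /andP[ba bA]; rewrite /mate; apply/andP/idP.
    move=> [aM]; case: pickP => /= [c /andP[_ cM] /eqP <- //|no].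
    have [c] := matching_on_edge_ex mM aM.
    by rewrite !inE => /andP[ca _] cM; have := no c; rewrite ca cM.
  move=> bM; split; first by apply/bigcupP; exists [set a; b]; rewrite // !inE eqxx.
  case: pickP => /= [c /andP[ca cM]|/(_ b)]; last by rewrite ba bM.
  by apply/eqP; apply: (matching_on_edge_uniq mM cM bM); rewrite eq_sym.
rewrite (partition_big mate (fun b => b \in A :\ a)) /=; last first.
  move=> M /andP[mM]; rewrite negbK => aM.
  have [b bA bM] := matching_on_edge_ex mM aM.
  by have := mateP M b mM bA; rewrite bM => /andP[_ /eqP ->].
rewrite (eq_bigr (fun=> herm #|A :\ a|.-1 x)); last first.
  move=> b bA; have := bA; rewrite !inE => /andP[ba bA'].
  have cAb : #|A :\ a :\ b| = #|A :\ a|.-1 by rewrite [#|A :\ a|](cardsD1 b) bA.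
  rewrite -cAb -IH; last first.
    rewrite cAb; lia.
  pose p : {set T} := [set a; b].
  rewrite (reindex_onto (fun M => p |: M) (fun M => M :\ p)) /=; last first.
    move=> M /andP[/andP[mM aM] mE]; rewrite setD1K //.
    by rewrite -(mateP M b mM bA) mE -(negbK (a \in _)) aM.
  apply: eq_big => M.
    rewrite -(@matching_on_add A a b M aA bA' _) -/p ?negbK; last by rewrite eq_sym.
    have [mM|] /= := boolP (matching_on A (p |: M)); last by [].
    rewrite mateP // setU11 /=.
    have [pM|pM] := boolP (p \in M); last by rewrite setU1K // eqxx.
    by apply/eqP => E; move: pM; rewrite -E !inE eqxx.
  move=> _; rewrite /cover bigcup_setU big_set1 -/(cover M).
  by rewrite !setDDl -setUA.
by rewrite sumr_const -mulr_natl natz.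
Qed.

End Matchings.

Lemma hermite_horner (n : nat) (x : int) : (hermite n%:Z).[x] = herm n x.
Proof.
rewrite -{2}(card_ord n) -cardsT -matching_sum /hermite horner_sum.
apply: eq_big => M => [|_].
  by rewrite /is_partial_matching /matching_on subsetT andbT.
by rewrite hornerXn /uncovered setTD.
Qed.

(** * Moebius numbers of the cographic lattice by Whitney's theorem *)

Lemma mobius_unique (disp : Order.disp_t) (T : finPOrderType disp) (x0 : T)
    (f : T -> int) : f x0 = 1 ->
  (forall y, (x0 < y)%O -> \sum_(z | (x0 <= z)%O && (z <= y)%O) f z = 0) ->
  forall y, (x0 <= y)%O -> mobius x0 y = f y.
Proof.
move=> f1 f0 y; move: {2}#|_|.+1 (ltnSn #|[set z : T | (z < y)%O]|) => n.
elim: n y => // n IH y ltn x0y; rewrite mobiusE.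
have [<- //|ne] := eqVneq x0 y.
have lt0 : (x0 < y)%O by rewrite lt_neqAle ne.
have := f0 y lt0; rewrite (bigD1 y) /= ?x0y ?lexx // => /eqP.
rewrite addr_eq0 => /eqP ->; congr (- _).
apply: eq_big => z; first by rewrite lt_neqAle -andbA [_ && (z != y)]andbC.
move=> /andP[x0z zy]; apply: IH => //; apply: leq_trans (ltn : (_ <= n)%N).
apply/proper_card/properP; split; last by exists z; rewrite !inE ?zy ?ltxx.
by apply/subsetP => t; rewrite !inE => /lt_trans; apply.
Qed.

(** Toggling a fixed element of [B] pairs subsets of opposite sign. *)
Lemma sum_sign_subsets (T : finType) (B : {set T}) :
  \sum_(A : {set T} | A \subset B) (-1) ^+ #|A| = (B == set0)%:R :> int.
Proof.
have [->|[e eB]] := set_0Vmem B.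
  by rewrite eqxx (big_pred1 set0) ?cards0 // => A; rewrite subset0.
have -> : (B == set0) = false by apply/negbTE/set0Pn; exists e.
rewrite (bigID (fun A : {set T} => e \in A)) /=.
rewrite (reindex_onto (fun A => e |: A) (fun A => A :\ e)) /=; last first.
  by move=> A /andP[_ eA]; rewrite setD1K.
rewrite [X in X + _](_ : _ = - \sum_(A : {set T} | (A \subset B) && (e \notin A)) (-1) ^+ #|A|).
  by rewrite addNr.
rewrite -sumrN; apply: eq_big => A => [|/andP[_ /eqP AE]].
  rewrite setU11 andbT subUset sub1set eB /=.
  have [eA|eA] := boolP (e \in A); last by rewrite setU1K // eqxx.
  rewrite andbF; apply/negP => /andP[_ /eqP AE].
  by move: eA; rewrite -AE !inE eqxx.
have eA : e \notin A by rewrite -AE !inE eqxx.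
by rewrite cardsU1 eA exprD expr1 mulN1r.
Qed.

Section CographicMobius.
Variables (R : realType) (d : nat) (G : digraph d).
Local Notation E := (edge G).
Local Notation lattice := (cographic_lattice R G).

Definition flat_of (A : {set E}) : lattice := SeqSub (cographic_flat_in R A).

Lemma flat_of_surj (X : lattice) : exists A, flat_of A = X.
Proof. by have /imageP[A _ XE] := valP X; exists A; apply: val_inj; rewrite XE. Qed.

Lemma mem_cographic_flat (A : {set E}) (lam : edge_fun R G) :
  (lam \in cographic_flat R A) = (lam \in cycle_space R G) && [forall e in A, lam e == 0].
Proof.
rewrite /cographic_flat memv_cap; apply: andb_id2l => lamV.
apply/subv_bigcapP/forall_inP => h e eA; have := h e eA.
  by rewrite -memvE mem_cographic_hyperplane => /andP[].
by rewrite -memvE mem_cographic_hyperplane lamV.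
Qed.

(** A Galois connection: the edge sets whose flat lies below [X] are exactly the subsets of one
    fixed set, which makes their signed sum computable. *)
Lemma flat_of_le (A : {set E}) (X : lattice) :
  (flat_of A <= X)%O = (A \subset [set e | (val X <= cographic_hyperplane R e)%VS]).
Proof.
have -> : (flat_of A <= X)%O = (val X <= cographic_flat R A)%VS by [].
have [B <-] := flat_of_surj X; rewrite /=.
rewrite {2}/cographic_flat subv_cap.
have -> : (cographic_flat R B <= cycle_space R G)%VS by apply: capvSl.
apply/subv_bigcapP/subsetP => [h e eA|h e eA]; first by rewrite inE h.
by have := h e eA; rewrite inE.
Qed.

Hypothesis no_coloop : forall e : E, ~~ (cycle_space R G <= cographic_hyperplane R e)%VS.

(** Summed over all flats below [Y], the right-hand side runs over the subsets of [up Y] and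
    vanishes unless [up Y] is empty. That happens only at the bottom, where [no_coloop] gives the
    value 1. *)
Lemma mobius_flats (X : lattice) :
  mobius (cographic_bot R G) X = \sum_(A : {set E} | flat_of A == X) (-1) ^+ #|A|.
Proof.
pose up (Y : lattice) := [set e : E | (val Y <= cographic_hyperplane R e)%VS].
have sum_le (Y : lattice) :
    \sum_(z | (cographic_bot R G <= z)%O && (z <= Y)%O)
      \sum_(A : {set E} | flat_of A == z) (-1) ^+ #|A| = (up Y == set0)%:R :> int.
  rewrite -sum_sign_subsets (partition_big flat_of (fun z => (z <= Y)%O)) /=; last first.
    by move=> A; rewrite flat_of_le.
  apply: eq_big => z; first by rewrite cographic_botP.
  move=> /andP[_ zY]; apply: eq_bigl => A.
  by case: eqP => [AE|]; rewrite ?andbF // andbT -flat_of_le AE zY.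
have up_bot : up (cographic_bot R G) = set0.
  apply/setP => e; rewrite !inE /= /cographic_flat big_set0 capvf.
  exact/negbTE/no_coloop.
apply: (mobius_unique (f := fun X => \sum_(A : {set E} | flat_of A == X) (-1) ^+ #|A|)).
- have := sum_le (cographic_bot R G); rewrite up_bot eqxx.
  rewrite (big_pred1 (cographic_bot R G)) // => z /=.
  by rewrite eq_le andbC.
- move=> Y ltY; rewrite sum_le; case: eqP => // upY.
  have [A AE] := flat_of_surj Y.
  have := lexx Y; rewrite -{1}AE flat_of_le -/(up Y) upY subset0 => /eqP A0.
  by move: ltY; rewrite -AE A0 ltxx.
- exact: cographic_botP.
Qed.

(** Both sides say that no nonzero cycle is supported off [A], that is, that the complement of [A]
    is a forest. *)
Lemma flat_of_top (A : {set E}) :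
  (flat_of A == cographic_top R G) =
  indep (fun (e : E) v => edge_vec R e 0 v) setT (~: A).
Proof.
have boundaryE (lam : edge_fun R G) v :
    boundary lam 0 v = \sum_e lam e * edge_vec R e 0 v.
  by rewrite /boundary summxE; apply: eq_bigr => e _; rewrite mxE.
rewrite eq_le cographic_topP /=.
have -> : (cographic_top R G <= flat_of A)%O = (cographic_flat R A <= cographic_flat R setT)%VS by [].
apply/subvP/asboolP => [sub f fA f0 e|ind lam].
  pose lam : edge_fun R G := [ffun e => f e].
  have : lam \in cographic_flat R A.
    rewrite mem_cographic_flat mem_cycle_space; apply/andP; split.
      apply/eqP/rowP => v; rewrite boundaryE mxE -[RHS](f0 v) ?inE //.
      by apply: eq_bigr => a _; rewrite ffunE.
    by apply/forall_inP => a aA; rewrite ffunE fA // !inE negbK.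
  move/sub; rewrite mem_cographic_flat => /andP[_ /forall_inP/(_ e)].
  by rewrite inE ffunE => /(_ isT)/eqP.
rewrite !mem_cographic_flat => /andP[lamV /forall_inP lamA]; rewrite lamV /=.
apply/forall_inP => e _; apply/eqP; apply: (ind lam) => [a|v _].
  by rewrite !inE negbK => /lamA/eqP.
by move: lamV; rewrite -boundaryE mem_cycle_space => /eqP ->; rewrite mxE.
Qed.

(** Passing to complements turns the sum over [A] into one over forests; the parity of [#|~: F|]
    produces the global sign. *)
Lemma mobius_top :
  mobius (cographic_bot R G) (cographic_top R G) =
  (-1) ^+ #|E| * indep_sum (fun (e : E) v => edge_vec R e 0 v) setT setT.
Proof.
rewrite mobius_flats /indep_sum (reindex_inj (inv_inj (@setCK _))) big_distrr /=.
apply: eq_big => F; first by rewrite subsetT flat_of_top setCK.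
move=> _; rewrite cardsCs setCK -signr_odd oddB ?max_card //.
by rewrite signr_addb !signr_odd.
Qed.

End CographicMobius.

(** * The oriented complete graph as an instance, and the conclusion *)

Section Complete.
Variables (R : realType) (m : nat) (o : complete_edge m -> bool).
Local Notation G := (complete_digraph o).
Local Notation inc := (fun (e : edge G) v => edge_vec R e 0 v).

Lemma complete_vecE (e : complete_edge m) :
  edge_vec R (e : edge G) =
  (-1) ^+ (~~ o e) *: (delta_mx 0 (val e).1 - delta_mx 0 (val e).2).
Proof.
have lt := valP e; have ne : ((val e).1 == (val e).2) = false.
  by apply/negbTE; rewrite -val_eqE neq_ltn lt.
rewrite /edge_vec /=; case: (o e); rewrite ?ne 1?eq_sym ?ne /=.
  by rewrite scale1r.
by rewrite expr1 scaleN1r opprB.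
Qed.

Lemma complete_ends (e : complete_edge m) :
  ends inc e = [set (val e).1; (val e).2].
Proof.
have lt := valP e; have ne : ((val e).1 == (val e).2) = false.
  by apply/negbTE; rewrite -val_eqE neq_ltn lt.
apply/setP => v; rewrite inE complete_vecE mxE mulf_eq0 signr_eq0 /= !mxE /= !inE.
have [->|_] := eqVneq v (val e).1; first by rewrite ne subr0 oner_eq0.
by case: (v == _) => /=; rewrite sub0r oppr_eq0 ?oner_eq0 ?eqxx.
Qed.

Lemma complete_edge_ex (a b : 'I_m) : a != b ->
  exists e : complete_edge m, exists s : R,
    ends inc e = [set a; b] /\
    s *: edge_vec R (e : edge G) = delta_mx 0 a - delta_mx 0 b.
Proof.
rewrite -val_eqE neq_ltn => /orP[lt|lt].
  exists (exist _ (a, b) lt), ((-1) ^+ (~~ o (exist _ (a, b) lt))).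
  by rewrite complete_ends complete_vecE scalerA -expr2 sqrr_sign scale1r.
exists (exist _ (b, a) lt), (- (-1) ^+ (~~ o (exist _ (b, a) lt))).
rewrite complete_ends complete_vecE scalerA mulNr -expr2 sqrr_sign.
by rewrite scaleN1r opprB setUC.
Qed.

Lemma complete_indep_sum : indep_sum inc setT setT = forest_val m m.
Proof.
have -> : setT = edges_in inc setT by apply/setP => e; rewrite !inE subsetT.
rewrite indep_sum_edges_in ?cardsT ?card_ord //.
- move=> e; rewrite complete_ends cards2.
  by have lt := valP e; rewrite -val_eqE neq_ltn lt.
- move=> e f; rewrite !complete_ends => /setP ef; apply/val_inj.
  have := valP e; have := valP f; have := ef (val e).1; have := ef (val e).2.
  rewrite !inE !eqxx orbT /= -!val_eqE /=.
  move=> /esym h2 /esym h1 ltf lte.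
  rewrite [val e]surjective_pairing [val f]surjective_pairing.
  by congr (_, _); apply: val_inj => /=; lia.
- by move=> a b /complete_edge_ex[e [s [eE _]]]; exists e.
- move=> e; rewrite /= complete_vecE.
  under eq_bigr do rewrite !mxE /=.
  rewrite -mulr_sumr sumrB.
  have sum1 (u : 'I_m) : \sum_(v < m) (v == u)%:R = 1 :> R.
    by rewrite (bigD1 u) //= eqxx big1 ?addr0 // => v /negPf ->.
  by rewrite !sum1 subrr mulr0.
Qed.

Lemma third_vertex (a b : 'I_m) : (2 < m)%N -> exists c, (c != a) && (c != b).
Proof.
move=> m3; have : (0 < #|~: [set a; b]|)%N.
  have := cardsC [set a; b]; rewrite card_ord cards2; lia.
by move=> /card_gt0P[c]; rewrite !inE negb_or; exists c.
Qed.

(** With a third vertex [c], the triangle through [e] and [c] carries a cycle that is nonzero on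
    [e]. *)
Lemma complete_no_coloop (e : edge G) : (2 < m)%N ->
  ~~ (cycle_space R G <= cographic_hyperplane R e)%VS.
Proof.
move=> m3; set a := (val e).1; set b := (val e).2.
have ab : a != b by have lt := valP e; rewrite -val_eqE neq_ltn lt.
have [c /andP[ca cb]] := third_vertex a b m3.
have [f [s [fE fv]]] : exists f : complete_edge m, exists s : R,
    ends inc f = [set b; c] /\
    s *: edge_vec R (f : edge G) = delta_mx 0 b - delta_mx 0 c.
  by apply: complete_edge_ex; rewrite eq_sym.
have [g [t [gE gv]]] := complete_edge_ex ca.
pose chi (r : R) (h : edge G) : edge_fun R G := [ffun x => r * (x == h)%:R].
have bd r h : boundary (chi r h) = r *: edge_vec R h.
  rewrite /boundary (bigD1 h) //= ffunE eqxx mulr1 big1 ?addr0 // => x /negPf xh.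
  by rewrite ffunE xh mulr0 scale0r.
(* The signs undo the orientations, so the boundary telescopes along a, b, c and back to a. *)
pose lam : edge_fun R G := chi ((-1) ^+ (~~ o e)) e + chi s f + chi t g.
apply/negP => /subvP/(_ lam); rewrite mem_cographic_hyperplane mem_cycle_space.
have -> : boundary lam = 0.
  rewrite /lam !linearD /= !bd fv gv complete_vecE scalerA -expr2 sqrr_sign scale1r.
  by rewrite -/a -/b !subrKA subrr.
rewrite eqxx => /(_ isT) /=; rewrite !ffunE eqxx mulr1.
have ef : (e == f) = false.
  apply/eqP => ef; have := complete_ends e; rewrite ef fE => /setP/(_ c).
  by rewrite !inE eqxx orbT -ef (negPf ca) (negPf cb).
have eg : (e == g) = false.
  apply/eqP => eg; have := complete_ends e; rewrite eg gE => /setP/(_ c).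
  by rewrite !inE eqxx -eg (negPf ca) (negPf cb).
by rewrite ef eg !mulr0 !addr0 signr_eq0.
Qed.

(** An edge touching [c] differs from [e], which avoids [c]; this supplies the detour around [e]
    through a third vertex. *)
Lemma complete_adj (e : edge G) (a b c : 'I_m) :
  (val e).1 != c -> (val e).2 != c -> (a == c) || (b == c) -> a != b ->
  adj_without e a b.
Proof.
move=> e1 e2 abc ab; have [f [_ [fE _]]] := complete_edge_ex ab.
move: fE; rewrite complete_ends => /setP fE.
have lt := valP f; have ne : (val f).1 != (val f).2 by rewrite -val_eqE neq_ltn lt.
have := fE (val f).1; have := fE (val f).2; rewrite !inE !eqxx orbT /= => f2 f1.
apply/existsP; exists f; apply/andP; split.
  apply/eqP => fe; have := fE c; rewrite !inE fe eq_sym (negPf e1) eq_sym (negPf e2).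
  by rewrite eq_sym [c == b]eq_sym abc.
move: f1 f2 ne; rewrite /=; case: (o f) => /=;
by move=> /esym/orP[]/eqP -> /esym/orP[]/eqP ->; rewrite !eqxx ?orbT // ?andbT.
Qed.

Lemma complete_no_isthmus (e : edge G) : (2 < m)%N -> ~~ isthmus e.
Proof.
move=> m3; rewrite /isthmus negbK.
have [c /andP[c1 c2]] := third_vertex (src e) (tgt e) m3.
have [e1 e2] : (val e).1 != c /\ (val e).2 != c.
  by move: c1 c2; rewrite /=; case: (o e) => h1 h2; rewrite ![_ == c]eq_sym.
apply: (@connect_trans _ _ c); apply: connect1; apply: (complete_adj e1 e2);
by rewrite ?eqxx ?orbT // eq_sym.
Qed.

End Complete.

Lemma complete2_isthmus (o : complete_edge 2 -> bool) :
  [exists e : edge (complete_digraph o), isthmus e].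
Proof.
pose e : complete_edge 2 := exist _ (ord0, ord_max) isT.
have eE (f : complete_edge 2) : f = e.
  apply/val_inj; case: f => -[[[|[|a]] ha] [[|[|b]] hb]] //= _.
  by congr (_, _); apply: val_inj.
apply/existsP; exists e; apply/negP => /connectP[[|y p]].
  by rewrite /=; case: (o e).
by move=> /= /andP[/existsP[f]]; rewrite (eE f) eqxx.
Qed.

Theorem theorem5p8 (R : realType) (m : nat) (o : complete_edge m -> bool) :
  (2 <= m)%N ->
  (mobius_coinvariant R (complete_digraph o))%:Z =
    (m%:Z - 2) * (hermite (m%:Z - 3)).[m%:Z - 1].
Proof.
(* For m = 2 the single edge is an isthmus, and the factor m - 2 vanishes on the other side. *)
case: m o => [|[|[|m]]] o // _.
  by rewrite /mobius_coinvariant complete2_isthmus subrr mul0r.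
rewrite /mobius_coinvariant ifN; last first.
  by rewrite negb_exists; apply/forallP => e; apply: complete_no_isthmus.
rewrite mobius_top => [|e]; last exact: complete_no_coloop.
rewrite complete_indep_sum.
have -> : m.+3%:Z - 3 = m%:Z by lia.
have -> : m.+3%:Z - 2 = m.+1%:Z by lia.
rewrite hermite_horner forest_val_top.
(* By parity, replacing the argument 1 - m by m - 1 costs only a sign, lost in the absolute value;
   at m - 1 the Hermite number is nonnegative. *)
have -> : 1 - m.+3%:Z = - (m.+3%:Z - 1) by ring.
rewrite hermN !abszM !abszX abszN1 !exp1n !mul1n PoszM.
by rewrite !gez0_abs // herm_ge0 //; lia.
Qed.
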